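(* Let $\nu\in(0,1]$ and $p=1+\nu$. Let $f:\mathbb{R}^n\to\mathbb{R}$ be Fréchet differentiable with $\nu$-Hölder continuous gradient on $\mathbb{R}^n$ with constant $L_\nu$, let $g:\mathbb{R}^n\to\mathbb{R}\cup\{+\infty\}$ be proper and lower semicontinuous, and set $\varphi:=f+g$. Suppose $\overline{x}=0$ is a $p$-calm point of $\varphi$ and $\varphi(\overline{x})=0$. Then there exists $\overline{\gamma}>0$ such that for every $\gamma\in(0,\overline{\gamma})$ and every $\varepsilon>0$ there is a neighborhood $U$ of $\overline{x}$ such that for any $x\in U$, $\mathbf{T}_{\gamma\varphi}^{p}(x)\ne\emptyset$, and moreover, if $y\in\mathbf{T}_{\gamma\varphi}^{p}(x)$, then $$\|y\|<\varepsilon,\qquad g(y)<g(\overline{x})+\varepsilon,\qquad \frac{1}{\gamma}\|x-y\|^{p-1}+\|\nabla f(x)-\nabla f(\overline{x})\|<\varepsilon.$$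
   Context: $\|\cdot\|$ and $\langle\cdot,\cdot\rangle$ are the Euclidean norm and inner product on $\mathbb{R}^n$. A function $h:\mathbb{R}^n\to\mathbb{R}\cup\{+\infty\}$ is proper if it is finite at some point. $f$ has a $\nu$-Hölder continuous gradient with constant $L_\nu\ge 0$ if $\|\nabla f(y)-\nabla f(x)\|\le L_\nu\|y-x\|^\nu$ for all $x,y\in\mathbb{R}^n$. A point $\overline{x}$ with $\psi(\overline{x})<+\infty$ is a $p$-calm point of a proper lower semicontinuous function $\psi:\mathbb{R}^n\to\mathbb{R}\cup\{+\infty\}$ (with constant $M$) if there is $M>0$ with $\psi(x)+M\|x-\overline{x}\|^p>\psi(\overline{x})$ for all $x\in\mathbb{R}^n$, $x\ne\overline{x}$. For $\gamma>0$, the high-order forward-backward splitting mapping (HiFBS) of $\varphi=f+g$ is the set-valued map $$\mathbf{T}_{\gamma\varphi}^{p}(x):=\operatorname*{arg\,min}_{y\in\mathbb{R}^n}\left\{f(x)+\langle\nabla f(x),y-x\rangle+g(y)+\frac{1}{p\gamma}\|x-y\|^p\right\}.$$ *)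

(* Defs.v *)
(* MathComp-Analysis. The space R^n is 'rV[R]_n for R : realType. *)
From HB Require Import structures.
From mathcomp Require Import all_boot all_order all_algebra.
From mathcomp Require Import all_classical all_reals all_analysis.

Set Implicit Arguments.
Unset Strict Implicit.
Unset Printing Implicit Defensive.

Import Order.TTheory GRing.Theory Num.Theory.
Import numFieldNormedType.Exports.

Local Open Scope classical_set_scope.
Local Open Scope ring_scope.

Definition dotv (R : realType) (n : nat) (x y : 'rV[R]_n) : R :=
  \sum_(i < n) x ord0 i * y ord0 i.

(* The norm [`|x|] that the library puts on ['rV[R]_n] is the sup norm. It
   induces the same topology and the same Fréchet differential as the Euclidean
   norm, so [nbhs], [lower_semicontinuous], [differentiable] and ['d f x] are
   used as they are; every quantitative statement uses [enorm]. *)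
Definition enorm (R : realType) (n : nat) (x : 'rV[R]_n) : R :=
  Num.sqrt (dotv x x).

Definition grad (R : realType) (n : nat) (f : 'rV[R]_n -> R) (x : 'rV[R]_n) :
    'rV[R]_n :=
  \row_(i < n) 'd f x (delta_mx ord0 i).

(* [grad f x] represents the Fréchet differential. *)
Lemma dotv_grad (R : realType) (n : nat) (f : 'rV[R]_n -> R) (x v : 'rV[R]_n) :
  dotv (grad f x) v = 'd f x v.
Proof.
rewrite [in RHS](row_sum_delta v) linear_sum; apply: eq_bigr => i _.
by rewrite linearZ /= mxE mulrC.
Qed.

Definition holder_gradient (R : realType) (n : nat) (f : 'rV[R]_n -> R)
    (nu L : R) : Prop :=
  forall x y : 'rV[R]_n,
    enorm (grad f y - grad f x) <= L * enorm (y - x) `^ nu.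

(* Functions with values in R U {+oo} are [\bar R]-valued functions avoiding
   [-oo]; this is part of properness. *)
Definition proper_fun (R : realType) (n : nat) (h : 'rV[R]_n -> \bar R) : Prop :=
  (forall x, (-oo < h x)%E) /\ (exists x, (h x < +oo)%E).

Definition calm_point (R : realType) (n : nat) (p : R)
    (psi : 'rV[R]_n -> \bar R) (xbar : 'rV[R]_n) : Prop :=
  (psi xbar < +oo)%E /\
  exists M : R, 0 < M /\
    forall x, x <> xbar ->
      (psi x + (M * enorm (x - xbar) `^ p)%:E > psi xbar)%E.

Definition argmin (R : realType) (T : Type) (h : T -> \bar R) : set T :=
  [set y | forall z, (h y <= h z)%E].

Definition HiFBS (R : realType) (n : nat) (p gamma : R) (f : 'rV[R]_n -> R)
    (g : 'rV[R]_n -> \bar R) (x : 'rV[R]_n) : set 'rV[R]_n :=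
  argmin (fun y : 'rV[R]_n =>
    ((f x + dotv (grad f x) (y - x))%:E + g y
     + ((p * gamma)^-1 * enorm (x - y) `^ p)%:E)%E).

(* Main.v *)
(* Write q_x for the function minimised by [HiFBS] and c = 1/(p gamma). The mean
   value theorem gives |f y - f x - <grad f x, y - x>| <= L |y - x|^p, so
   calmness at 0 and |y|^p <= 4 (|x|^p + |x - y|^p) yield
     q_x(y) >= (c - L - 4 M) |x - y|^p - 4 M |x|^p,
   whereas q_x(0) <= (L + c) |x|^p. Once c >= L + 4 M + 1, comparing y with 0
   confines the minimisers of q_x to |x - y| <= (L + c + 4 M) |x|: they exist by
   compactness, and all three estimates are O(|x|^nu) as x tends to 0. *)
Require Import Defs.
From HB Require Import structures.
From mathcomp Require Import all_boot all_order all_algebra.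
From mathcomp Require Import all_classical all_reals all_analysis.
From mathcomp Require Import ring lra.

Set Implicit Arguments.
Unset Strict Implicit.
Unset Printing Implicit Defensive.

Import Order.TTheory GRing.Theory Num.Theory.
Import numFieldNormedType.Exports.

Local Open Scope classical_set_scope.
Local Open Scope ring_scope.

(** * Euclidean inner product and norm *)

Lemma dotvDl (R : realType) n (x y z : 'rV[R]_n) :
  dotv (x + y) z = dotv x z + dotv y z.
Proof.
by rewrite -big_split; apply: eq_bigr => i _; rewrite !mxE mulrDl.
Qed.

Lemma dotvC (R : realType) n (x y : 'rV[R]_n) : dotv x y = dotv y x.
Proof. by apply: eq_bigr => i _; rewrite mulrC. Qed.

Lemma dotvDr (R : realType) n (x y z : 'rV[R]_n) :
  dotv z (x + y) = dotv z x + dotv z y.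
Proof. by rewrite dotvC dotvDl !(dotvC z). Qed.

Lemma dotvZl (R : realType) n a (x y : 'rV[R]_n) :
  dotv (a *: x) y = a * dotv x y.
Proof.
by rewrite /dotv mulr_sumr; apply: eq_bigr => i _; rewrite !mxE mulrA.
Qed.

Lemma dotvZr (R : realType) n a (x y : 'rV[R]_n) :
  dotv x (a *: y) = a * dotv x y.
Proof. by rewrite dotvC dotvZl dotvC. Qed.

Lemma dotvNl (R : realType) n (x y : 'rV[R]_n) : dotv (- x) y = - dotv x y.
Proof. by rewrite -scaleN1r dotvZl mulN1r. Qed.

Lemma dotvNr (R : realType) n (x y : 'rV[R]_n) : dotv x (- y) = - dotv x y.
Proof. by rewrite dotvC dotvNl dotvC. Qed.

Lemma dotvv_ge0 (R : realType) n (x : 'rV[R]_n) : 0 <= dotv x x.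
Proof. by apply: sumr_ge0 => i _; rewrite -expr2 sqr_ge0. Qed.

Lemma enorm_ge0 (R : realType) n (x : 'rV[R]_n) : 0 <= enorm x.
Proof. exact: sqrtr_ge0. Qed.

Lemma sqr_enorm (R : realType) n (x : 'rV[R]_n) : enorm x ^+ 2 = dotv x x.
Proof. by rewrite sqr_sqrtr// dotvv_ge0. Qed.

Lemma enormZ (R : realType) n a (x : 'rV[R]_n) : enorm (a *: x) = `|a| * enorm x.
Proof.
by rewrite /enorm dotvZl dotvZr mulrA -expr2 sqrtrM ?sqr_ge0// sqrtr_sqr.
Qed.

Lemma enormN (R : realType) n (x : 'rV[R]_n) : enorm (- x) = enorm x.
Proof. by rewrite -scaleN1r enormZ normrN1 mul1r. Qed.

Lemma enorm0 (R : realType) n : enorm (0 : 'rV[R]_n) = 0.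
Proof. by rewrite -(scale0r 0) enormZ normr0 mul0r. Qed.

Lemma enorm_eq0 (R : realType) n (x : 'rV[R]_n) : enorm x = 0 -> x = 0.
Proof.
move=> x0; have : dotv x x == 0 by rewrite -sqr_enorm x0 expr0n.
rewrite psumr_eq0 => [|i _]; last by rewrite -expr2 sqr_ge0.
move=> /allP x0i; apply/rowP => i; rewrite mxE.
by have /= := x0i i (mem_index_enum i); rewrite -expr2 sqrf_eq0 => /eqP.
Qed.

(** Cauchy-Schwarz, one-sided: expanding the square of [enorm y *: x - enorm x *: y] gives 2 |x| |y|
    (|x| |y| - <x, y>) >= 0, and the positive factor cancels once both vectors are nonzero. *)
Lemma dotv_le (R : realType) n (x y : 'rV[R]_n) :
  dotv x y <= enorm x * enorm y.
Proof.
have [/eqP/enorm_eq0 ->|x0] := boolP (enorm x == 0).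
  by rewrite -(scale0r 0) dotvZl mul0r mulr_ge0 ?enorm_ge0.
have [/eqP/enorm_eq0 ->|y0] := boolP (enorm y == 0).
  by rewrite -(scale0r 0) dotvZr mul0r mulr_ge0 ?enorm_ge0.
have xy0 : 0 < enorm x * enorm y.
  by rewrite mulr_gt0// lt_neqAle eq_sym ?x0 ?y0 enorm_ge0.
have := dotvv_ge0 (enorm y *: x - enorm x *: y).
rewrite !(dotvDl, dotvDr, dotvNl, dotvNr, dotvZl, dotvZr) (dotvC y x).
rewrite -!sqr_enorm => h.
have {h} : 0 <= 2 * (enorm x * enorm y) * (enorm x * enorm y - dotv x y).
  by apply: le_trans h _; rewrite le_eqVlt; apply/orP; left; apply/eqP; ring.
by rewrite pmulr_rge0 ?subr_ge0// mulr_gt0.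
Qed.

Lemma enormD (R : realType) n (x y : 'rV[R]_n) :
  enorm (x + y) <= enorm x + enorm y.
Proof.
rewrite -(@ler_pXn2r _ 2)// ?nnegrE ?addr_ge0 ?enorm_ge0//.
rewrite sqr_enorm !(dotvDl, dotvDr) (dotvC y x) -!sqr_enorm.
have := dotv_le x y; lra.
Qed.

Lemma enorm_leD (R : realType) n (x y : 'rV[R]_n) :
  enorm x <= enorm (x - y) + enorm y.
Proof. by have := enormD (x - y) y; rewrite subrK. Qed.

Lemma enorm_distC (R : realType) n (x y : 'rV[R]_n) :
  enorm (x - y) = enorm (y - x).
Proof. by rewrite -enormN opprB. Qed.

Lemma dotv_continuous (R : realType) n (T : topologicalType)
    (A B : T -> 'rV[R]_n) : continuous A -> continuous B ->
  continuous (fun t => dotv (A t) (B t)).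
Proof.
move=> cA cB; apply: (@continuous_big R _ +%R 0 _ (@add_continuous R^o)) => i _ t.
have cC (C : T -> 'rV[R]_n) :
    continuous C -> {for t, continuous (fun t => C t ord0 i)}.
  move=> cC; apply: (@continuous_comp _ _ _ C (fun v : 'rV[R]_n => v ord0 i)).
    exact: cC.
  exact: coord_continuous.
by apply: cvgM; exact: cC.
Qed.

Lemma enorm_continuous (R : realType) n : continuous (@enorm R n).
Proof.
move=> x; apply: continuous_comp; last exact: sqrt_continuous.
by apply: dotv_continuous => t; exact: cvg_id.
Qed.

(** Boundedness is measured in the sup norm, so this comparison, with the continuity of [enorm],
    makes closed Euclidean balls compact. *)
Lemma mx_norm_le_enorm (R : realType) n (x : 'rV[R]_n) : `|x| <= enorm x.
Proof.
rewrite [leLHS]/Num.norm /= mx_normrE; apply/bigmax_leP; split.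
  exact: enorm_ge0.
move=> [i j] _ /=; rewrite ord1 -sqrtr_sqr ler_wsqrtr// /dotv (bigD1 j)//=.
by rewrite expr2 lerDl sumr_ge0// => k _; rewrite -expr2 sqr_ge0.
Qed.

(** If a <= b, then (a + b)^p <= (2 b)^p = 2^p b^p <= 4 b^p. The crude constant avoids any convexity
    argument. *)
Lemma powRD_le4 (R : realType) (a b p : R) : 0 <= a -> 0 <= b -> 0 < p <= 2 ->
  (a + b) `^ p <= 4 * (a `^ p + b `^ p).
Proof.
move=> a0 b0 /andP[p0 p2].
wlog ab : a b a0 b0 / a <= b.
  move=> W; have [/W|/ltW/W] := leP a b; first exact.
  by rewrite addrC (addrC (_ `^ _)); exact.
have : (a + b) `^ p <= (2 * b) `^ p.
  by apply: ge0_ler_powR; rewrite ?nnegrE; lra.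
move=> /le_trans; apply; rewrite powRM//.
have : (2 : R) `^ p <= 4.
  apply: (@le_trans _ _ (2 `^ 2%:R)); first by rewrite ler_powR//; lra.
  by rewrite powR_mulrn//; lra.
move=> h; have := powR_ge0 a p; have := powR_ge0 b p => bp ap.
apply: (@le_trans _ _ (4 * b `^ p)); first by rewrite ler_wpM2r.
lra.
Qed.

(** * Lower semicontinuity and existence of minimisers *)

Lemma lower_semicontinuousD (R : realType) (T : topologicalType)
    (h k : T -> \bar R) :
  (forall x, -oo < h x)%E -> (forall x, -oo < k x)%E ->
  lower_semicontinuous h -> lower_semicontinuous k ->
  lower_semicontinuous (fun x => h x + k x)%E.
Proof.
move=> hNy kNy hlsc klsc x a ahk.
(* The threshold a is split as b + (a - b), so that each summand exceeds its share strictly and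
   keeps doing so nearby. For finite values r and s, b is the midpoint of a - s and r. *)
have [b [bh abk]] : exists b : R, (b%:E < h x)%E /\ ((a - b)%:E < k x)%E.
  move: (hNy x) (kNy x) ahk; case: (h x) => [r| |]// _; case: (k x) => [s| |]// _.
  - rewrite lte_fin => ars; exists ((r + a - s) / 2); rewrite !lte_fin.
    by split; lra.
  - by move=> _; exists (r - 1); rewrite lte_fin ltry; split => //; lra.
  - by move=> _; exists (a - s + 1); rewrite lte_fin ltry; split => //; lra.
  - by move=> _; exists 0; rewrite !ltry.
have [V Vx hV] := hlsc _ _ bh; have [W Wx kW] := klsc _ _ abk.
exists (V `&` W); first exact: filterI.
move=> y [/hV bhy /kW abky].
by rewrite -(subrK b a) addrC EFinD lteD.
Qed.

Lemma continuous_lower_semicontinuous (R : realType) (T : topologicalType)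
    (h : T -> R) : continuous h -> lower_semicontinuous (EFin \o h).
Proof.
move=> hc; apply/lower_semicontinuousP => a.
rewrite (_ : [set _ | _] = h @^-1` [set r | a < r]).
  by apply: open_comp => //; exact: open_gt.
by apply/seteqP; split => x /=; rewrite lte_fin.
Qed.

(** The sublevel sets [B z], for z in K, form a chain, hence a filter base. It clusters at some y in
    K, and lower semicontinuity forbids h z < h y: near y the values of h would stay above h z, away
    from [B z]. *)
Lemma lower_semicontinuous_argmin (R : realType) (T : topologicalType)
    (K : set T) (h : T -> \bar R) :
  compact K -> K !=set0 -> lower_semicontinuous h ->
  exists2 y, K y & forall z, K z -> (h y <= h z)%E.
Proof.
move=> cK [x0 Kx0] hlsc.
pose B z := K `&` [set y | (h y <= h z)%E].
have FB : Filter (filter_from K B).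
  apply: filter_from_filter; first by exists x0.
  move=> z w Kz Kw; have [zw|/ltW wz] := leP (h z) (h w).
    by exists z => // y [Ky yz]; do 2 split => //; exact: le_trans zw.
  by exists w => // y [Ky yw]; do 2 split => //; exact: le_trans wz.
have PB : ProperFilter (filter_from K B).
  by apply: filter_from_proper => z Kz; exists z; split => /=.
have [|y [Ky cly]] := cK _ PB; first by exists x0 => // y [].
exists y => // z Kz; rewrite leNgt; apply/negP => zy.
(* Lower semicontinuity takes real thresholds only, while h z may be -oo. *)
have [a [za ay]] : exists a : R, (h z <= a%:E)%E /\ (a%:E < h y)%E.
  move: zy; case: (h z) => [r| |].
  - by move=> ry; exists r.
  - by rewrite ltNge leey.
  - case: (h y) => [r| |]// _; last by exists 0; rewrite leNye ltry.
    by exists (r - 1); rewrite leNye lte_fin; split => //; lra.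
have [V Vy aV] := hlsc _ _ ay.
have [|w [[_ /= wz] /aV]] := cly (B z) V _ Vy; first by exists z.
by rewrite ltNge (le_trans wz za).
Qed.

(* The mean value theorem gives the constant [L], not the sharp [L / (1 + nu)]. *)
Lemma descent (R : realType) n (nu L : R) (f : 'rV[R]_n -> R) :
  0 < nu -> 0 <= L -> (forall x, differentiable f x) ->
  holder_gradient f nu L ->
  forall x y, `|f y - (f x + dotv (grad f x) (y - x))| <=
    L * enorm (y - x) `^ (1 + nu).
Proof.
move=> nu0 L0 df hf x y.
pose l (t : R^o) : 'rV[R]_n := x + t *: (y - x).
have dl (t : R) : is_derive t 1 (f \o l : R -> R) (dotv (grad f (l t)) (y - x)).
  have dlt : is_diff (t : R^o) l (fun s => s *: (y - x)).
    by apply: is_diff_eq; rewrite add0r.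
  have dft : is_diff (l t) f ('d f (l t)) by apply: DiffDef.
  have dfl := is_diff_comp dlt dft.
  apply: DeriveDef; first exact/derivable1_diffP.
  by rewrite deriveE// diff_val /= scale1r dotv_grad.
have [|c /andP[c0 c1]] := MVT_segment ler01 (fun t _ => dl t).
  apply: continuous_subspaceT => t.
  exact/differentiable_continuous/derivable1_diffP.
rewrite /= {1 2}/l /= scale1r scale0r addr0 (addrC x) subrK subr0 mulr1 => fyx.
rewrite opprD addrA fyx -dotvNl -dotvDl.
(* Cauchy-Schwarz on the difference of the gradients at [l c] and x; then |l c - x| = c |y - x| <=
   |y - x| brings in the Hölder bound. *)
apply: (@le_trans _ _ (enorm (grad f (l c) - grad f x) * enorm (y - x))).
  rewrite ler_norml dotv_le andbT lerNl -dotvNl.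
  by apply: le_trans (dotv_le _ _) _; rewrite enormN.
rewrite -(@mulr_powRB1 _ _ (1 + nu)) ?enorm_ge0 ?addr_gt0// mulrCA mulrC.
rewrite (addrC 1) addrK; apply: ler_wpM2l (enorm_ge0 _) _ _ _.
apply: le_trans (hf _ _) _; apply: ler_wpM2l => //.
apply: ge0_ler_powR; rewrite ?nnegrE ?enorm_ge0 ?(ltW nu0)//.
rewrite /l (addrC x) addrK enormZ.
by rewrite ger0_norm// ler_piMl ?enorm_ge0.
Qed.

(** A minimiser over the compact ball of radius r is global, because the ball contains 0 and no
    value outside it is below h 0. *)
Lemma coercive_argmin (R : realType) n (h : 'rV[R]_n -> \bar R) (r : R) :
  lower_semicontinuous h -> 0 <= r ->
  (forall y, r < enorm y -> (h 0%R <= h y)%E) -> argmin h !=set0.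
Proof.
move=> hlsc r0 hr; pose K := [set y : 'rV[R]_n | enorm y <= r].
have K0 : K 0 by rewrite /K /= enorm0.
have cK : compact K.
  apply: bounded_closed_compact.
    exists r; split; first exact: num_real.
    move=> s rs y Ky; apply: le_trans (mx_norm_le_enorm y) _.
    exact: le_trans Ky (ltW rs).
  apply: (@closed_comp _ _ (@enorm R n) [set s | s <= r]).
    by move=> y _; exact: enorm_continuous.
  exact: closed_le.
have [|y Ky hy] := lower_semicontinuous_argmin cK _ hlsc; first by exists 0.
exists y => z; have [/hy//|rz] := leP (enorm z) r.
exact: le_trans (hy _ K0) (hr _ rz).
Qed.

(* The objective of [HiFBS p gamma f g x] is [fb_model p (p * gamma)^-1 f g x]. *)
Definition fb_model (R : realType) (n : nat) (p c : R) (f : 'rV[R]_n -> R)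
    (g : 'rV[R]_n -> \bar R) (x y : 'rV[R]_n) : \bar R :=
  ((f x + dotv (grad f x) (y - x))%:E + g y + (c * enorm (x - y) `^ p)%:E)%E.

(** For a >= 0 the condition c e^p > a amounts to e > (a / c)^(1/p), by monotonicity of the power on
    nonnegative reals, and this is open. For a < 0 it always holds. *)
Lemma lower_semicontinuous_powR (R : realType) (T : topologicalType) (e : T -> R)
    (c p : R) : 0 < c -> 0 < p -> (forall t, 0 <= e t) -> continuous e ->
  lower_semicontinuous (fun t => (c * e t `^ p)%:E).
Proof.
move=> c0 p0 e0 ce t a; rewrite lte_fin => ate.
have [a0|a0] := ltP a 0.
  exists setT; first exact: filterT.
  by move=> s _; rewrite lte_fin (lt_le_trans a0)// mulr_ge0 ?powR_ge0// ltW.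
have ac0 : 0 <= a / c by rewrite divr_ge0// ltW.
pose q := (a / c) `^ p^-1.
have aE : a / c = q `^ p by rewrite -powRrM mulVf ?gt_eqF// powRr1.
have le_pow s : (a < c * e s `^ p) = (q < e s).
  rewrite mulrC -ltr_pdivrMr// aE; apply/idP/idP; last first.
    by apply: gt0_ltr_powR; rewrite ?nnegrE ?powR_ge0.
  apply: contraTT; rewrite -!leNgt.
  by apply: ge0_ler_powR; rewrite ?nnegrE ?powR_ge0 ?(ltW p0).
exists (e @^-1` [set s | q < s]).
  apply: (ce t); apply: open_nbhs_nbhs; split; first exact: open_gt.
  by rewrite /= -le_pow.
by move=> s /=; rewrite -le_pow lte_fin.
Qed.

Lemma continuous_addr_cst (R : realType) (T : topologicalType) (a : R)
    (h : T -> R) : continuous h -> continuous (fun t => a + h t).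
Proof.
by move=> ch t; apply: cvgD; [exact: cvg_cst | exact: ch].
Qed.

Lemma fb_model_lsc (R : realType) n (p c : R) (f : 'rV[R]_n -> R)
    (g : 'rV[R]_n -> \bar R) (x : 'rV[R]_n) :
  0 < p -> 0 < c -> (forall y, (-oo < g y)%E) -> lower_semicontinuous g ->
  lower_semicontinuous (fb_model p c f g x).
Proof.
move=> p0 c0 gNy glsc.
have cB : continuous (fun y : 'rV[R]_n => y - x)
  by move=> y; apply: (@continuousB _ _ _ id (cst x) y);
    [exact: cvg_id|exact: cst_continuous].
have cB' : continuous (fun y : 'rV[R]_n => x - y)
  by move=> y; apply: (@continuousB _ _ _ (cst x) id y);
    [exact: cst_continuous|exact: cvg_id].
apply: lower_semicontinuousD => [y|y||].
- by move: (gNy y); case: (g y) => [s| |]// _; rewrite -?EFinD ltNyr.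
- exact: ltNyr.
- apply: lower_semicontinuousD => //; first by move=> y; exact: ltNyr.
  have cf : continuous (fun y : 'rV[R]_n => f x + dotv (grad f x) (y - x)).
    apply: continuous_addr_cst.
    by apply: (dotv_continuous (A := cst (grad f x)) _ cB); exact: cst_continuous.
  exact: (continuous_lower_semicontinuous cf).
- apply: lower_semicontinuous_powR => // [y|y]; first exact: enorm_ge0.
  by apply: continuous_comp; [exact: cB'|exact: enorm_continuous].
Qed.

(** * Calmness and comparison of objective values with the value at 0 *)

Lemma calm_point_growth (R : realType) n (p : R) (phi : 'rV[R]_n -> \bar R) :
  p != 0 -> calm_point p phi 0 -> phi 0 = 0%E ->
  exists2 M : R, 0 < M & forall y, ((- (M * enorm y `^ p))%:E <= phi y)%E.
Proof.
move=> p0 [_ [M [M0 hM]]] phi0; exists M => // y.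
(* Calmness says nothing at the calm point itself; there both sides are 0. *)
have [->|/eqP/hM] := eqVneq y 0.
  by rewrite phi0 enorm0 powR0// mulr0 oppr0.
rewrite phi0 subr0; case: (phi y) => [r| |]//; last by rewrite leey.
rewrite -EFinD lte_fin lee_fin; lra.
Qed.

(** With X = |x|^p and D = |x - y|^p, the summand 1 in the lower bound on c leaves q_x(y) >= D - 4 M
    X, against q_x(0) <= (L + c) X. Hence K X < D suffices. *)
Lemma fb_model_far (R : realType) n (nu L M c : R) (f : 'rV[R]_n -> R)
    (g : 'rV[R]_n -> \bar R) (x y : 'rV[R]_n) :
  0 < nu <= 1 -> 0 <= L -> (forall x, differentiable f x) ->
  holder_gradient f nu L -> 0 < M ->
  (forall y, ((- (M * enorm y `^ (1 + nu)))%:E <= (f y)%:E + g y)%E) ->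
  ((f 0%R)%:E + g 0%R = 0)%E -> L + 4 * M + 1 <= c ->
  (L + c + 4 * M) * enorm x < enorm (x - y) ->
  (fb_model (1 + nu) c f g x 0%R < fb_model (1 + nu) c f g x y)%E.
Proof.
move=> /andP[nu0 nu1] L0 df hf M0 hM fg0 hc; set K := L + c + 4 * M => xy.
have K1 : 1 <= K by rewrite /K; lra.
(* Since K >= 1 and 1 + nu >= 1, K is at most its own power, so the same K serves after raising to
   the exponent. *)
have {}xy : K * enorm x `^ (1 + nu) < enorm (x - y) `^ (1 + nu).
  apply: (@le_lt_trans _ _ ((K * enorm x) `^ (1 + nu))).
    by rewrite le1r_powRZ ?enorm_ge0//; lra.
  apply: gt0_ltr_powR => //; rewrite ?nnegrE ?mulr_ge0 ?enorm_ge0//; lra.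
have y4 : enorm y `^ (1 + nu) <=
    4 * (enorm x `^ (1 + nu) + enorm (x - y) `^ (1 + nu)).
  apply: le_trans (powRD_le4 _ _ _); rewrite ?enorm_ge0//; last lra.
  apply: ge0_ler_powR; rewrite ?nnegrE ?addr_ge0 ?enorm_ge0//; first lra.
  by rewrite addrC enorm_distC; exact: enorm_leD.
have := descent nu0 L0 df hf x y; rewrite (enorm_distC y).
have := descent nu0 L0 df hf x 0; rewrite sub0r enormN dotvNr.
(* One side of each estimate is kept: the linear model of f at x exceeds f by at most L X at 0, and
   falls below f by at most L D at y. *)
rewrite !ler_norml => /andP[d0 _] /andP[_ dy].
move: fg0 (hM y); rewrite /fb_model subr0 sub0r dotvNr.
case: (g 0) => [g0| |]// -[fg0]; case: (g y) => [gy| |]//; last first.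
  by rewrite addeC/= ltry.
rewrite -!EFinD lee_fin lte_fin => gM.
have : L * enorm (x - y) `^ (1 + nu) + 4 * M * enorm (x - y) `^ (1 + nu) +
   1 * enorm (x - y) `^ (1 + nu) <= c * enorm (x - y) `^ (1 + nu).
  by rewrite -!mulrDl ler_wpM2r ?powR_ge0.
have : M * enorm y `^ (1 + nu) <=
   M * (4 * (enorm x `^ (1 + nu) + enorm (x - y) `^ (1 + nu))).
  by rewrite ler_wpM2l// ltW.
move: xy d0 dy gM {y4}; rewrite /K.
move: (_ `^ _) (_ `^ _) (_ `^ _) (dotv _ _) (dotv _ _) => X D Y u v.
clear -fg0; lra.
Qed.

Theorem theorem24 (R : realType) (n : nat) (nu p L : R)
  (f : 'rV[R]_n -> R) (g phi : 'rV[R]_n -> \bar R)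
  (hnu : 0 < nu <= 1) (hp : p = 1 + nu) (hL : 0 <= L)
  (hdiff : forall x : 'rV[R]_n, differentiable f x)
  (hhol : holder_gradient f nu L)
  (hgproper : proper_fun g) (hglsc : lower_semicontinuous g)
  (hphi : forall x, phi x = ((f x)%:E + g x)%E)
  (xbar : 'rV[R]_n) (hxbar : xbar = 0)
  (hcalm : calm_point p phi xbar) (hphi0 : phi xbar = 0%E) :
  exists gammabar : R, 0 < gammabar /\
    forall gamma : R, 0 < gamma < gammabar ->
    forall eps : R, 0 < eps ->
    exists U : set 'rV[R]_n, nbhs xbar U /\
      forall x, U x ->
        HiFBS p gamma f g x !=set0 /\
        forall y, HiFBS p gamma f g x y ->
          [/\ enorm y < eps,
              (g y < g xbar + eps%:E)%E &
              gamma^-1 * enorm (x - y) `^ (p - 1)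
                + enorm (grad f x - grad f xbar) < eps].
Proof.
subst p xbar; have [nu0 nu1] := andP hnu.
have p0 : 0 < 1 + nu by lra.
have [M M0 hM] := calm_point_growth (lt0r_neq0 p0) hcalm hphi0.
have {}hM y : ((- (M * enorm y `^ (1 + nu)))%:E <= (f y)%:E + g y)%E.
  by rewrite -hphi.
have fg0 : ((f 0%R)%:E + g 0%R = 0)%E by rewrite -hphi.
have N0 : 0 < L + 4 * M + 1 by lra.
(* Chosen so that gamma below this bound means c > L + 4 M + 1. *)
exists ((1 + nu) * (L + 4 * M + 1))^-1; split.
  by rewrite invr_gt0 mulr_gt0.
move=> gamma /andP[gamma0 gammaN] eps eps0.
set c := ((1 + nu) * gamma)^-1.
have c0 : 0 < c by rewrite invr_gt0 mulr_gt0.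
have hc : L + 4 * M + 1 <= c.
  move: gammaN; rewrite /c -[ltRHS]mul1r -[leRHS]mul1r.
  rewrite ltr_pdivlMr ?mulr_gt0// ler_pdivlMr ?mulr_gt0// => /ltW.
  lra.
pose K := L + c + 4 * M; have K1 : 1 <= K by rewrite /K; lra.
pose G := enorm (grad f 0).
have G0 : 0 <= G by exact: enorm_ge0.
have igamma0 : 0 < gamma^-1 by rewrite invr_gt0.
(* With t = |x|^nu, the three groups are the coefficients of t bounding |y|, g y - g 0 and the last
   quantity. All are nonnegative, so C t < eps gives the three estimates at once. *)
pose C := (1 + K) + ((G + L) * (1 + K) + c) + (gamma^-1 * K + L).
have GLK : 0 <= (G + L) * (1 + K) by rewrite mulr_ge0//; lra.
have gK : 0 <= gamma^-1 * K by rewrite mulr_ge0 ?(ltW igamma0)//; lra.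
have C0 : 0 < C by rewrite /C; lra.
(* The bound 1 makes |x| and |x|^(1 + nu) at most t; the other one gives C t < eps. *)
pose d := Num.min 1 ((eps / C) `^ nu^-1).
have d0 : 0 < d by rewrite lt_min ltr01 powR_gt0// divr_gt0.
exists [set x | enorm x < d]; split.
  apply: (@enorm_continuous R n 0 [set s | s < d]).
  by apply: open_nbhs_nbhs; split; [exact: open_lt|rewrite /= enorm0].
move=> x /=; rewrite lt_min => /andP[x1 xd].
have x0 := enorm_ge0 x; set t := enorm x `^ nu.
have t0 : 0 <= t by exact: powR_ge0.
have Ct : C * t < eps.
  rewrite mulrC -ltr_pdivlMr//.
  have -> : eps / C = ((eps / C) `^ nu^-1) `^ nu.
    by rewrite -powRrM mulVf ?gt_eqF// powRr1// ltW// divr_gt0.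
  by apply: gt0_ltr_powR; rewrite ?nnegrE ?powR_ge0.
have xt : enorm x <= t.
  have [->|xN0] := eqVneq (enorm x) 0; first exact: t0.
  by rewrite ger1_powR// lt_neqAle eq_sym xN0 x0/= ltW.
have xpt : enorm x `^ (1 + nu) <= t.
  rewrite -mulr_powRB1// (addrC 1) addrK -/t.
  by rewrite ler_piMl// ltW.
have t1 : t <= 1.
  apply: (@le_trans _ _ (1 `^ nu)); last by rewrite powR1.
  by apply: ge0_ler_powR; rewrite ?nnegrE ?(ltW nu0) ?(ltW x1).
have far y : K * enorm x < enorm (x - y) ->
    (fb_model (1 + nu) c f g x 0%R < fb_model (1 + nu) c f g x y)%E.
  exact: (@fb_model_far R n nu L M c).
split.
  apply: (@coercive_argmin R n (fb_model (1 + nu) c f g x) ((1 + K) * enorm x)).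
  - by apply: fb_model_lsc => //; case: hgproper.
  - by rewrite mulr_ge0//; lra.
  (* If |y| > (1 + K) |x|, then |x - y| > K |x| by the triangle inequality. *)
  - move=> y xy; apply/ltW/far.
    have := enorm_leD y x; rewrite enorm_distC.
    by move: xy; lra.
move=> y hy.
have near : enorm (x - y) <= K * enorm x.
  by rewrite leNgt; apply/negP => /far; rewrite ltNge => /negP; apply; exact: hy.
have yx : enorm y <= (1 + K) * enorm x.
  have := enorm_leD y x; rewrite enorm_distC.
  by move: near; lra.
have yt : enorm y <= (1 + K) * t.
  by apply: le_trans yx _; rewrite ler_wpM2l//; lra.
have dx : enorm (grad f x - grad f 0) <= L * t.
  by have := hhol 0 x; rewrite subr0.
have Cexp : C * t = (1 + K) * t + ((G + L) * (1 + K) * t + c * t) +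
    (gamma^-1 * K * t + L * t) by rewrite /C !mulrDl.
have h1 : 0 <= (1 + K) * t by rewrite mulr_ge0//; lra.
have h2 : 0 <= (G + L) * (1 + K) * t by rewrite mulr_ge0.
have h3 : 0 <= c * t by rewrite mulr_ge0// ltW.
have h4 : 0 <= gamma^-1 * K * t by rewrite mulr_ge0.
have h5 : 0 <= L * t by rewrite mulr_ge0.
split; first by move: Ct; rewrite Cexp; lra.
  have := hy 0; rewrite -!/(fb_model (1 + nu) c f g x _) /fb_model subr0 sub0r.
  (* Here |grad f x| <= G + L t <= G + L, because t <= 1. *)
  have gx : - dotv (grad f x) y <= (G + L) * (1 + K) * t.
    rewrite -dotvNr; apply: le_trans (dotv_le _ _) _; rewrite enormN -mulrA.
    apply: ler_pM; rewrite ?enorm_ge0//.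
    apply: le_trans (enorm_leD _ (grad f 0)) _; rewrite addrC lerD2l.
    by apply: le_trans dx _; rewrite ler_piMr.
  have cx : c * enorm x `^ (1 + nu) <= c * t by rewrite ler_wpM2l// ltW.
  have cxy : 0 <= c * enorm (x - y) `^ (1 + nu) by rewrite mulr_ge0 ?powR_ge0// ltW.
  (* g 0 is finite because f 0 + g 0 = 0, and g y = +oo contradicts minimality against 0. *)
  move: fg0; case: (g 0) => [g0| |]// _; case: (g y) => [gy| |]//.
    rewrite -!EFinD lee_fin lte_fin dotvDr !dotvNr.
    by move: Ct; rewrite Cexp; lra.
  by rewrite -EFinD ltNyr.
rewrite (addrC 1) addrK.
have : gamma^-1 * enorm (x - y) `^ nu <= gamma^-1 * K * t.
  rewrite -mulrA ler_wpM2l ?(ltW igamma0)//.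
  (* (K |x|)^nu = K^nu t <= K t, since K >= 1 and nu <= 1. *)
  apply: (@le_trans _ _ ((K * enorm x) `^ nu)).
    by apply: ge0_ler_powR; rewrite ?nnegrE ?mulr_ge0 ?enorm_ge0 ?(ltW nu0)//; lra.
  rewrite powRM//; last lra.
  by rewrite ler_wpM2r// ler1_powR.
by move: dx Ct; rewrite Cexp; lra.
Qed.
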